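(* Let $n,r\in\mathbb N$ with $r\geq 2$ and $r$ dividing $n$. Let $G$ be a graph on $n$ vertices with degree sequence $d_1\leq\dots\leq d_n$ such that $d_i\geq (r-2)n/r+i$ for all $i<n/r$, and $d_{n/r+1}\geq (r-1)n/r$. Suppose further that no vertex of $G$ of degree less than $(r-1)n/r$ lies in a copy of $K_{r+1}$ in $G$. Then $G$ contains a perfect $K_r$-packing.
   Context: A perfect $K_r$-packing in $G$ is a collection of vertex-disjoint copies of the complete graph $K_r$ in $G$ covering all vertices of $G$. The degree sequence lists vertex degrees in non-decreasing order. *)

(* Defs.v *)
From mathcomp Require Export all_boot.

Set Implicit Arguments.
Unset Strict Implicit.
Unset Printing Implicit Defensive.

(* A finite simple graph is a symmetric irreflexive relation on a finType. *)
Definition simple_graph (T : finType) (e : rel T) : Prop :=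
  symmetric e /\ irreflexive e.

Definition degree (T : finType) (e : rel T) (x : T) : nat :=
  #|[set y | e x y]|.

Definition degree_sequence (T : finType) (e : rel T) : seq nat :=
  sort leq [seq degree e x | x <- enum T].

(* The sequence d_1 <= ... <= d_n is indexed from 1, meaningful for
   1 <= i <= #|T|. *)
Definition deg_at (T : finType) (e : rel T) (i : nat) : nat :=
  nth 0 (degree_sequence e) i.-1.

(* A copy of K_r in a simple graph is determined by its vertex set. *)
Definition is_Kr_copy (T : finType) (e : rel T) (r : nat) (K : {set T}) : Prop :=
  #|K| = r /\ {in K &, forall x y, x != y -> e x y}.

Definition perfect_Kr_packing (T : finType) (e : rel T) (r : nat)
    (P : {set {set T}}) : Prop :=
  [/\ {in P, forall K, is_Kr_copy e r K}, trivIset P & cover P = [set: T]].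

(* Main.v *)
Require Import Defs.
From mathcomp Require Import all_boot zify.

(**
Write [n = m * r].  A vertex [x] of least degree, if it has degree less than
[(r - 1) m], lies in a copy of [K_r]: choose its other vertices greedily, all but the
last of degree at least [(r - 1) m].  As [x] is in no [K_(r+1)], every
remaining vertex is adjacent to at most [r - 1] vertices of this copy, so deleting
the copy preserves the hypotheses with [m - 1] in place of [m].  Once all degrees are
at least [(r - 1) m], the Hajnal-Szemeredi theorem for the complement graph gives the
packing.

Hajnal-Szemeredi follows the short proof of Kierstead and Kostochka.  Adding the edges
at one vertex at a time leaves one colour class [a] too small and one class [b] too
large.  A class is accessible if vertices can be shifted from it, class by class, down
to [a]; if [b] is accessible we are done.  Otherwise take a set [J] of accessible
classes none of which is needed to reach [a] from the others.  A vertex [y] outside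
the accessible classes and its only neighbour [z] in some class of [J] may be swapped.
If [z] can move to another accessible class, shifting repairs the accessible part plus
[y], and induction on the number of colours handles the rest.  Otherwise a count
produces two nonadjacent such [y] with the same [z], and swapping one of them with
[z] makes the class of the other accessible as well.
*)

Set Implicit Arguments.
Unset Strict Implicit.
Unset Printing Implicit Defensive.

(** * Reachability inside a set of vertices of a digraph *)

Section Reachability.

Variable C : finType.
Implicit Types (g : rel C) (F K : {set C}) (a i j : C).

(** Arcs must have both ends in [F], but the empty path is always allowed: [a] reaches itself even
    when [a] is not in [F]. *)
Definition reaches g F a i : bool :=
  connect [rel i j | [&& i \in F, j \in F & g i j]] i a.

Lemma reaches_refl g F a : reaches g F a a.
Proof. exact: connect0. Qed.

Lemma reaches_step g F a i j :
  i \in F -> j \in F -> g i j -> reaches g F a j -> reaches g F a i.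
Proof.
by move=> iF jF gij; apply/connect_trans/connect1; rewrite /= iF jF.
Qed.

(** Every vertex of a path to [a] itself reaches [a], so only such vertices need to lie in [F'].
    This is how a path is shown to avoid a vertex that does not reach [a]. *)
Lemma reaches_sub g g' F F' a i :
  {in F &, subrel g g'} ->
  (forall j, j \in F -> reaches g F a j -> j \in F') ->
  reaches g F a i -> reaches g' F' a i.
Proof.
move=> gg' FF' /connectP[p]; elim: p i => [|j p IHp] i /=.
  by move=> _ ->; apply: reaches_refl.
case/andP=> /and3P[iF jF gij] pth lst.
have Rj : reaches g F a j by apply/connectP; exists p.
apply: (@reaches_step _ _ _ _ j); last exact: IHp.
- by apply: FF' => //; apply: reaches_step gij Rj.
- exact: FF'.
- exact: gg'.
Qed.

Lemma reaches_mono g F F' a i :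
  F \subset F' -> reaches g F a i -> reaches g F' a i.
Proof. by move=> /subsetP FF'; apply: reaches_sub => // j /FF'. Qed.

(** A path without repetition never returns to [i], so after its first arc it stays in [F :\ i]. *)
Lemma reaches_inv g F a i : reaches g F a i -> i != a ->
  [/\ i \in F & exists j, [/\ j \in F :\ i, g i j & reaches g (F :\ i) a j]].
Proof.
case/connectP=> p pth ->; case: (shortenP pth) => {pth} p'.
case: p' => [|j p'] /=; first by rewrite eqxx.
case/andP=> /and3P[iF jF gij] pth /and3P[ip' _ _] _ _; split=> //.
move: ip'; rewrite inE negb_or => /andP[ij ip'].
exists j; split=> //; first by rewrite !inE eq_sym ij.
apply/connectP; exists p' => //.
elim: p' j {gij jF} ij ip' pth => //= k p' IHp j ij.
rewrite inE negb_or => /andP[ik ip'] /andP[/and3P[jF kF gjk] pth].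
by rewrite !inE ![_ == i]eq_sym ij ik jF kF gjk /= IHp.
Qed.

Definition accessible g K a : {set C} := [set i in K | reaches g K a i].

(** The vertices dominated by [w]: they reach [a], but only through [w]. *)
Definition cut_off g K a w : {set C} :=
  [set i in accessible g K a :\ w | ~~ reaches g (K :\ w) a i].

Lemma cut_off_root g K a w : a \notin cut_off g K a w.
Proof. by rewrite inE reaches_refl andbF. Qed.

Lemma reaches_target g F a i : reaches g F a i -> i != a -> a \in F.
Proof.
case/connectP=> p; elim: p i => [|j p IHp] i /=; first by move=> _ ->; rewrite eqxx.
case/andP=> /and3P[_ jF _] pth lst _; case: (eqVneq j a) jF => [->//|ja _].
exact: IHp pth lst ja.
Qed.

Lemma cut_off_self g K a : cut_off g K a a = accessible g K a :\ a.
Proof.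
apply/setP=> i; rewrite inE andb_idr // => /setD1P[ia _].
by apply/negP=> /reaches_target/(_ ia); rewrite !inE eqxx.
Qed.

(* A nonempty cut-off set of least size works as [J]: for [w] in it, [cut_off w]
   is strictly smaller, hence empty. *)
Lemma exists_terminal_set g K a :
    a \in K -> accessible g K a != [set a] ->
  exists u J, [/\ u \in accessible g K a, J != set0,
    J \subset accessible g K a :\ u :\ a,
    {in J & accessible g K a :\: (u |: J), forall w i, ~~ g w i} &
    {in J, forall w, {in accessible g K a :\ w, forall i,
      reaches g (K :\ w) a i}}].
Proof.
move=> aK accNa; set A := accessible g K a.
have aA : a \in A by rewrite inE aK reaches_refl.
have Ta : cut_off g K a a != set0.
  rewrite cut_off_self; apply: contra accNa => /eqP A0.
  by rewrite -/A -(setD1K aA) A0 setU0.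
case: (@arg_minnP _ a (fun u => (u \in A) && (cut_off g K a u != set0))
  (fun u => #|cut_off g K a u|)); first by rewrite aA.
move=> u /andP[uA Tu] minu; exists u, (cut_off g K a u).
have JA : cut_off g K a u \subset A :\ u.
  by apply/subsetP=> i; rewrite inE => /andP[].
have AK : A \subset K by apply/subsetP=> i; rewrite inE => /andP[].
split=> //.
- by rewrite subsetD1 JA cut_off_root.
- move=> w i wJ /setDP[iA]; rewrite inE in_set1 negb_or => /andP[iu iJ].
  apply: contraL wJ => gwi; rewrite inE negb_and negbK orbC.
  have [wAu|_] := boolP (w \in A :\ u); rewrite /= ?orbF ?orbT //.
  have [wu wA] := setD1P wAu.
  move: iJ; rewrite inE in_setD1 iu iA /= negbK; apply: reaches_step gwi.
    by rewrite in_setD1 wu (subsetP AK).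
  by rewrite in_setD1 iu (subsetP AK).
move=> w wJ; rewrite -/A.
have [wu wA] := setD1P (subsetP JA w wJ).
have [T0|Tw] := eqVneq (cut_off g K a w) set0.
  by move=> i iAw; have := in_set0 i; rewrite -T0 inE iAw => /negbFE.
suff : False by [].
have := minu w; rewrite wA Tw => /(_ isT); rewrite leqNgt => /negP[].
have NRw : ~~ reaches g (K :\ u) a w by move: wJ; rewrite inE => /andP[].
(* As [w] does not reach [a] off [u], a path to [a] off [u] also avoids [w]. *)
have transfer i : reaches g (K :\ u) a i -> reaches g (K :\ w) a i.
  apply: reaches_sub => // j /setD1P[_ jK] Rj; rewrite !inE jK andbT.
  by apply: contraNneq NRw => <-.
apply: proper_card; apply/properP; split; last first.
  by exists w => //; rewrite !inE eqxx.
apply/subsetP=> i; rewrite !inE => /andP[/and3P[iw iK Ri] NRi].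
rewrite iK Ri !andbT; apply/andP; split; last exact: contra (@transfer i) NRi.
(* [w] does not cut off [u]: the vertex after [u] on a simple path reaches [a] off [u], hence off
   [w]. *)
apply: contraNneq NRi => iu; rewrite {i}iu in iw iK Ri *.
case: (eqVneq u a) => [->|ua]; first exact: reaches_refl.
case: (reaches_inv Ri ua) => _ [j [jKu guj Rj]].
have [ju jK] := setD1P jKu.
apply: (reaches_step _ _ guj (transfer _ Rj)); rewrite !inE ?iw //.
by rewrite jK andbT; apply: contraNneq NRw => <-.
Qed.

End Reachability.

(** * Colourings *)

Section Colouring.

Variables (T C : finType) (h : rel T).
Implicit Types (U S : {set T}) (c d : T -> C) (x y z : T) (F K J : {set C}).
Implicit Types (i j l a b : C) (s : nat).

Definition colour_class U c i : {set T} := [set x in U | c x == i].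

Definition colour_preim U c J : {set T} := [set x in U | c x \in J].

Definition nbrs U x : nat := \sum_(y in U) h x y.

Definition free U c x i : bool := [forall y in colour_class U c i, ~~ h x y].

Definition movable U c : rel C :=
  [rel i j | [exists x in colour_class U c i, free U c x j]].

Definition proper_on U c : Prop := {in U &, forall x y, h x y -> c x != c y}.

Definition equitable U K s c : Prop :=
  [/\ proper_on U c, {in U, forall x, c x \in K} &
      {in K, forall i, #|colour_class U c i| = s}].

(* Class [a] has [s - 1] elements and class [b] has [s + 1]; the sizes are stated
   additively to avoid truncated subtraction. *)
Definition nearly_equitable U K s c a b : Prop :=
  [/\ proper_on U c, {in U, forall x, c x \in K}, [/\ a \in K, b \in K & a != b] &
      {in K, forall i, #|colour_class U c i| + (i == a) = s + (i == b)}].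

Lemma sum_colour_preim U c J (f : T -> nat) :
  \sum_(x in colour_preim U c J) f x =
  \sum_(i in J) \sum_(x in colour_class U c i) f x.
Proof.
rewrite (partition_big c (mem J)) /=; last by move=> x; rewrite inE => /andP[].
apply: eq_bigr => i iJ; apply: eq_bigl => x; rewrite !inE.
by case: eqP => [->|]; rewrite ?iJ ?andbT ?andbF.
Qed.

Lemma card_colour_preim U c J :
  #|colour_preim U c J| = \sum_(i in J) #|colour_class U c i|.
Proof.
rewrite -sum1_card sum_colour_preim.
by apply: eq_bigr => i _; rewrite sum1_card.
Qed.

Lemma colour_preimS U c J J' :
  J \subset J' -> colour_preim U c J \subset colour_preim U c J'.
Proof.
by move=> /subsetP JJ'; apply/subsetP=> x; rewrite !inE => /andP[-> /JJ'].
Qed.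

Lemma nbrs_gt0P U x : reflect (exists2 y, y \in U & h x y) (0 < nbrs U x).
Proof.
rewrite lt0n; apply: (iffP idP) => [|[y yU hxy]].
  rewrite sum_nat_eq0 => /forall_inPn[y yU]; rewrite eqb0 negbK; by exists y.
by rewrite /nbrs (bigD1 y) //= hxy.
Qed.

Lemma nbrs_gt0 U c x i : ~~ free U c x i -> 0 < nbrs (colour_class U c i) x.
Proof.
by move/forall_inPn=> [y yi]; rewrite negbK => hxy; apply/nbrs_gt0P; exists y.
Qed.

Lemma nbrs_split U c J x :
  nbrs U x = nbrs (colour_preim U c J) x + nbrs (colour_preim U c (~: J)) x.
Proof.
rewrite /nbrs (bigID (fun y => c y \in J)) /=.
by congr (_ + _); apply: eq_bigl => y; rewrite !inE.
Qed.

Lemma eq_free U c U' c' x i :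
  colour_class U c i = colour_class U' c' i -> free U c x i = free U' c' x i.
Proof. by rewrite /free => ->. Qed.

Lemma eq_movable U c U' c' i j :
    colour_class U c i = colour_class U' c' i ->
    colour_class U c j = colour_class U' c' j ->
  movable U c i j = movable U' c' i j.
Proof.
by rewrite /movable /= => -> ej; apply: eq_existsb => x; rewrite (eq_free _ ej).
Qed.

Lemma eq_reaches U c U' c' F a i :
    {in F, forall l, colour_class U c l = colour_class U' c' l} ->
  reaches (movable U c) F a i -> reaches (movable U' c') F a i.
Proof.
move=> eqc; apply: reaches_sub => // k l kF lF.
by rewrite (@eq_movable U c U' c') ?eqc.
Qed.

Hypothesis h_sym : symmetric h.
Hypothesis h_irr : irreflexive h.

Lemma proper_on_recolour U c z i :
  proper_on U c -> free (U :\ z) c z i -> proper_on (z |: U) [eta c with z |-> i].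
Proof.
move=> cU /forall_inP fz x y; rewrite !in_setU1 /=.
case: (eqVneq x z) => [->|xz] /=; case: (eqVneq y z) => [->|yz] /= xU yU.
- by rewrite h_irr.
- by apply: contraTneq => ci; apply: fz; rewrite !inE yz yU ci eqxx.
- by rewrite h_sym; apply: contraTneq => ci; apply: fz; rewrite !inE xz xU ci eqxx.
- exact: cU.
Qed.

Lemma colour_class_recolour U c z i l : z \notin U ->
  colour_class (z |: U) [eta c with z |-> i] l =
  if l == i then z |: colour_class U c l else colour_class U c l.
Proof.
move=> zU; apply/setP=> x; rewrite (fun_if (fun A : {set T} => x \in A)) !inE /=.
case: (eqVneq x z) => [->|xz] /=; rewrite ?(negPf zU) ?if_same //.
by rewrite eq_sym; case: eqP.
Qed.

(* An uncoloured vertex is absorbed by shifting one vertex along each arc of a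
   path of movable classes leading to [a]. *)
Lemma insert_vertex U c F a i z :
    z \notin U -> proper_on U c -> i \in F -> free U c z i ->
    reaches (movable U c) F a i ->
  exists d, [/\ proper_on (z |: U) d,
    forall l, l \notin F -> colour_class (z |: U) d l = colour_class U c l &
    forall l, #|colour_class (z |: U) d l| = #|colour_class U c l| + (l == a)].
Proof.
have [n] := ubnP #|F|; elim: n => // n IHn in U c F i z * => leFn.
move=> zU cU iF fz Ri.
have zNcl d l : z \notin colour_class U d l by rewrite inE (negPf zU).
have DzU : U :\ z = U by apply/setDidPl; rewrite disjoint_sym disjoints1.
have [ia|ia] := eqVneq i a.
  exists [eta c with z |-> a]; rewrite -ia; split=> [|l lF|l].
  - by apply: proper_on_recolour; rewrite ?DzU.
  - rewrite colour_class_recolour // ifN //.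
    by apply: contraNneq lF => ->.
  - rewrite colour_class_recolour //; case: eqP => [->|] /=; last by rewrite addn0.
    by rewrite cardsU1 zNcl addnC.
have [_ [j [jF /= /exists_inP[x xi fx] Rj]]] := reaches_inv Ri ia.
have [xU /eqP cx] : x \in U /\ c x == i by move: xi; rewrite inE => /andP[].
have eqcl l : l != i -> colour_class U c l = colour_class (U :\ x) c l.
  move=> li; apply/setP=> y; rewrite !inE; case: (eqVneq y x) => [->|//] /=.
  by rewrite cx eq_sym (negPf li) andbF.
have ji : j != i by move: jF; rewrite !inE => /andP[].
(* The vertex [x] that can move to [j] gives its place to [z] and is inserted in turn. The recursion
   works in [F :\ i], so it leaves class [i] alone and [z] still fits there. *)
have [||||||d] := IHn (U :\ x) c (F :\ i) j x.
- by move: leFn; rewrite (cardsD1 i F) iF.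
- by rewrite !inE eqxx.
- by move=> y y' /setD1P[_ yU] /setD1P[_ yU']; apply: cU.
- by [].
- by rewrite -(eq_free _ (eqcl j ji)).
- by apply: eq_reaches Rj => l /setD1P[li _]; apply: eqcl.
rewrite setD1K // => -[dU deq dcard].
have dclsi : colour_class U d i = colour_class (U :\ x) c i.
  by apply: deq; rewrite !inE eqxx.
exists [eta d with z |-> i]; split=> [|l lF|l].
- apply: proper_on_recolour; rewrite ?DzU //.
  apply/forall_inP=> y; rewrite dclsi !inE => /andP[/andP[_ yU] cy].
  by move/forall_inP: fz; apply; rewrite !inE yU.
- have li : l != i by apply: contraNneq lF => ->.
  rewrite colour_class_recolour // (negPf li) eqcl //; apply: deq.
  by rewrite !inE (negPf lF) andbF.
- rewrite colour_class_recolour //; case: eqP => [->|/eqP li]; last first.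
    by rewrite dcard -eqcl.
  rewrite cardsU1 zNcl dclsi (negPf ia) addn0 (cardsD1 x (colour_class U c i)) xi.
  congr (_ + #|pred_of_set _|); apply/setP=> y.
  by rewrite !inE; case: (y == x).
Qed.

Lemma insert_vertex_equitable U K s c F a i z :
    F \subset K -> z \notin U -> proper_on U c -> {in U, forall x, c x \in K} ->
    {in K, forall l, #|colour_class U c l| + (l == a) = s} ->
    i \in F -> free U c z i -> reaches (movable U c) F a i ->
  exists d, equitable (z |: U) K s d.
Proof.
move=> FK zU cU cK cs iF fz /(insert_vertex zU cU iF fz)[d [dU deq dcard]].
exists d; split=> // [x xU|l lK]; last by rewrite dcard cs.
have [dF|dF] := boolP (d x \in F); first exact: (subsetP FK).
have : x \in colour_class (z |: U) d (d x) by rewrite inE xU eqxx.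
by rewrite deq // inE => /andP[xU' /eqP <-]; apply: cK.
Qed.

(** Take out of [b] the vertex that moves along the first arc towards [a]. Then only [a] is short of
    [s], and reinserting the vertex fills it. *)
Lemma equitable_of_accessible U K s c a b :
    nearly_equitable U K s c a b -> b \in accessible (movable U c) K a ->
  exists d, equitable U K s d.
Proof.
case=> cU cK [aK bK ab] cs; rewrite inE => /andP[_ Rb].
rewrite eq_sym in ab.
have [_ [j [jK /= /exists_inP[x xb fx] Rj]]] := reaches_inv Rb ab.
have [xU /eqP cx] : x \in U /\ c x == b by move: xb; rewrite inE => /andP[].
have eqcl l : l != b -> colour_class U c l = colour_class (U :\ x) c l.
  move=> li; apply/setP=> y; rewrite !inE; case: (eqVneq y x) => [->|//] /=.
  by rewrite cx eq_sym (negPf li) andbF.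
have jb : j != b by move: jK; rewrite !inE => /andP[].
rewrite -(setD1K xU); apply: (insert_vertex_equitable (subsetDl K [set b]) (a := a) (c := c) _ _ _ _ jK).
- by rewrite !inE eqxx.
- by move=> y y' /setD1P[_ yU] /setD1P[_ yU']; apply: cU.
- by move=> y /setD1P[_ yU]; apply: cK.
- move=> l lK; have := cs l lK; have [->|lb] := eqVneq l b; last by rewrite eqcl ?addn0.
  rewrite (negPf ab) (cardsD1 x) xb /= addn0 addn1 add1n addn0 => -[<-].
  by congr #|pred_of_set _|; apply/setP=> y; rewrite !inE; case: (y == x).
- by rewrite -(eq_free _ (eqcl j jb)).
- by apply: eq_reaches Rj => l /setD1P[li _]; apply: eqcl.
Qed.

Lemma leq_nbrs U U' x : U \subset U' -> nbrs U x <= nbrs U' x.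
Proof.
move=> /subsetP UU'; rewrite /nbrs [leqRHS](bigID (mem U)) /=.
rewrite [X in _ <= X + _](eq_bigl (mem U)) ?leq_addr // => y.
by rewrite andb_idl // => /UU'.
Qed.

Lemma sum_nbrsC U S : \sum_(x in U) nbrs S x = \sum_(y in S) nbrs U y.
Proof.
rewrite /nbrs exchange_big /=; apply: eq_bigr => y _; apply: eq_bigr => x _.
by rewrite h_sym.
Qed.

Lemma card_leq_nbrs U c J x :
    {in J, forall i, ~~ free U c x i} -> #|J| <= nbrs (colour_preim U c J) x.
Proof.
move=> nf; rewrite /nbrs sum_colour_preim -sum1_card.
by apply: leq_sum => i /nf; apply: nbrs_gt0.
Qed.

(** Every vertex outside a maximal independent set has a neighbour in it, so the closed
    neighbourhoods of its members cover [U]. *)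
Lemma maximal_independent U :
  exists2 S : {set T}, S \subset U & {in S &, forall x y, ~~ h x y} /\
    #|U| <= \sum_(x in S) (nbrs U x).+1.
Proof.
pose indep (S : {set T}) :=
  (S \subset U) && [forall x in S, forall y in S, ~~ h x y].
have [|S] := @ex_maxset _ indep.
  by exists set0; rewrite /indep sub0set; apply/forall_inP=> x; rewrite inE.
case/maxsetP=> /andP[SU /forall_inP iS] maxS.
have {}iS : {in S &, forall x y, ~~ h x y}.
  by move=> x y /iS/forall_inP; apply.
exists S => //; split=> //.
have -> : \sum_(x in S) (nbrs U x).+1 = \sum_(x in U) (nbrs S x + (x \in S)).
  rewrite big_split /= sum_nbrsC.
  have -> : \sum_(x in U) (x \in S) = \sum_(x in S) 1.
    rewrite [LHS]big_mkcond [RHS]big_mkcond; apply: eq_bigr => x _.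
    by have [/(subsetP SU)->|_] := boolP (x \in S); last case: ifP.
  by rewrite -big_split /=; apply: eq_bigr => x _; rewrite addn1.
rewrite -sum1_card; apply: leq_sum => x xU.
have [//|xS] := boolP (x \in S); first by rewrite addn1.
rewrite addn0; apply: contraNT xS; rewrite -leqNgt leqn0 => /eqP nx.
have hx y : y \in S -> ~~ h x y.
  move=> yS; apply/negP=> hxy; suff: 0 < nbrs S x by rewrite nx.
  by apply/nbrs_gt0P; exists y.
have <- : x |: S = S; last by rewrite setU11.
apply: maxS; last exact: subsetUr.
rewrite /indep subUset sub1set xU SU; apply/forall_inP=> y yS; apply/forall_inP=> y'.
move: yS; rewrite !inE => /orP[/eqP->|yS] /orP[/eqP->|y'S].
- by rewrite h_irr.
- exact: hx.
- by rewrite h_sym; apply: hx.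
- exact: iS.
Qed.

(** * Gluing colourings with disjoint palettes *)

Definition glue U (c d : T -> C) : T -> C := fun x => if x \in U then c x else d x.

Section Glue.

Variables (U U' : {set T}) (K K' : {set C}) (c d : T -> C).
Hypothesis KK' : [disjoint K & K'].
Hypothesis UU' : [disjoint U & U'].
Hypothesis cK : {in U, forall x, c x \in K}.
Hypothesis dK : {in U', forall x, d x \in K'}.

Lemma glue_l x : x \in U -> glue U c d x = c x.
Proof. by rewrite /glue => ->. Qed.

Lemma glue_r x : x \in U' -> glue U c d x = d x.
Proof. by move=> xU'; rewrite /glue ifN // (disjointFl UU'). Qed.

Lemma glue_in : {in U :|: U', forall x, glue U c d x \in K :|: K'}.
Proof.
by move=> x /setUP[] xU; rewrite inE; [rewrite glue_l ?cK|rewrite glue_r ?dK ?orbT].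
Qed.

Lemma glue_proper : proper_on U c -> proper_on U' d -> proper_on (U :|: U') (glue U c d).
Proof.
move=> cU dU x y /setUP[] xU /setUP[] yU; [rewrite !glue_l|
  rewrite (glue_l xU) (glue_r yU)|rewrite (glue_r xU) (glue_l yU)|rewrite !glue_r] => //.
- exact: cU.
- move=> _; have := cK xU; apply: contraTneq => ->.
  by rewrite (disjointFl KK' (dK yU)).
- move=> _; have := cK yU; apply: contraTneq => <-.
  by rewrite (disjointFl KK' (dK xU)).
- exact: dU.
Qed.

Lemma glue_class_l i : i \in K ->
  colour_class (U :|: U') (glue U c d) i = colour_class U c i.
Proof.
move=> iK; apply/setP=> x; rewrite !inE.
have [xU|xU] := boolP (x \in U); first by rewrite glue_l.
have [xU'|//] := boolP (x \in U'); rewrite glue_r //=.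
by apply: contraTF iK => /eqP <-; rewrite (disjointFl KK') ?dK.
Qed.

Lemma glue_class_r i : i \in K' ->
  colour_class (U :|: U') (glue U c d) i = colour_class U' d i.
Proof.
move=> iK; apply/setP=> x; rewrite !inE.
have [xU'|xU'] := boolP (x \in U'); first by rewrite orbT glue_r.
have [xU|//] := boolP (x \in U); rewrite glue_l //=.
by apply: contraTF iK => /eqP <-; rewrite (disjointFr KK') ?cK.
Qed.

Lemma glue_equitable s :
  equitable U K s c -> equitable U' K' s d ->
  equitable (U :|: U') (K :|: K') s (glue U c d).
Proof.
move=> [cU _ cs] [dU _ ds]; split; [exact: glue_proper|exact: glue_in|].
by move=> i /setUP[] iK; [rewrite glue_class_l ?cs|rewrite glue_class_r ?ds].
Qed.

End Glue.

(** * Improving a nearly equitable colouring *)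

Section NearlyEquitable.

Variables (U : {set T}) (K : {set C}) (s : nat) (c : T -> C) (a b : C).
Hypothesis near : nearly_equitable U K s c a b.
Hypothesis deg_lt : {in U, forall x, nbrs U x < #|K|}.
Hypothesis IH : forall (U' : {set T}) (K' : {set C}), K' \proper K ->
  {in U', forall x, nbrs U' x < #|K'|} -> #|U'| = #|K'| * s ->
  exists d, equitable U' K' s d.

Local Notation cls := (colour_class U c).
Local Notation mov := (movable U c).
Local Notation A := (accessible mov K a).
Local Notation B := (K :\: A).
Local Notation VA := (colour_preim U c A).
Local Notation VB := (colour_preim U c B).

Hypothesis bB : b \notin A.

Let cU : proper_on U c. Proof. by case: near. Qed.
Let cK : {in U, forall x, c x \in K}. Proof. by case: near. Qed.
Let aK : a \in K. Proof. by case: near => _ _ []. Qed.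
Let bK : b \in K. Proof. by case: near => _ _ []. Qed.
Let ab : a != b. Proof. by case: near => _ _ []. Qed.
Let cs : {in K, forall i, #|cls i| + (i == a) = s + (i == b)}.
Proof. by case: near. Qed.

Let aA : a \in A. Proof. by rewrite inE aK reaches_refl. Qed.
Let AK : A \subset K. Proof. by apply/subsetP=> i; rewrite inE => /andP[]. Qed.

Let card_K : #|K| = #|A| + #|B|.
Proof. by rewrite -(cardsID A K) (setIidPr AK). Qed.

Let B_proper : B \proper K.
Proof.
rewrite properE subsetDl; apply/subsetPn; exists a => //.
by rewrite inE aA.
Qed.

Let A_B_disjoint : [disjoint A & B].
Proof. by rewrite disjoint_sym disjoints_subset subsetDr. Qed.

Let VA_VB : U = VA :|: VB.
Proof.
apply/setP=> x; rewrite in_setU ![x \in colour_preim _ _ _]inE in_setD.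
by have [/cK->|//] := boolP (x \in U); case: (c x \in A).
Qed.

Let VA_VB_disjoint : [disjoint VA & VB].
Proof.
rewrite -setI_eq0; apply/eqP/setP=> x.
rewrite in_setI ![x \in colour_preim _ _ _]inE in_setD in_set0.
by case: (c x \in A); rewrite ?andbF.
Qed.

Let nbrs_VA_VB x : nbrs U x = nbrs VA x + nbrs VB x.
Proof.
rewrite (nbrs_split U c A); congr (_ + nbrs _ x); apply/setP=> z.
rewrite ![z \in colour_preim _ _ _]inE in_setD in_setC.
by have [/cK->|//] := boolP (z \in U); rewrite andbT.
Qed.

Let VBP y : y \in VB -> [/\ y \in U, c y \in K & c y \notin A].
Proof. by rewrite inE in_setD => /and3P[-> -> ->]. Qed.

Let card_cls_A i : i \in A -> #|cls i| + (i == a) = s.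
Proof.
move=> iA; rewrite cs ?(subsetP AK) //.
by rewrite (_ : i == b = false) ?addn0 //; apply: contraNF bB => /eqP <-.
Qed.

(** The oversized class [b] lies in [B] and the undersized class [a] does not. *)
Let card_VB : #|VB| = #|B| * s + 1.
Proof.
rewrite card_colour_preim (eq_bigr (fun i => s + (i == b))); last first.
  move=> i /setDP[iK iA]; rewrite -cs // (_ : i == a = false) ?addn0 //.
  by apply: contraNF iA => /eqP ->.
rewrite big_split /= sum_nat_const (bigD1 b) /=; last by rewrite in_setD bB.
by rewrite eqxx big1 // => i /andP[_ /negPf->].
Qed.

(** Otherwise [y] could move to class [i], which would make its own class accessible. *)
Let VB_not_free y i : y \in VB -> i \in A -> ~~ free U c y i.
Proof.
move=> /VBP[yU yK yA] iA; apply: contra yA => fy.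
rewrite inE yK; apply: (reaches_step yK (subsetP AK _ iA)); last first.
  by move: iA; rewrite inE => /andP[].
by apply/exists_inP; exists y; rewrite // inE yU eqxx.
Qed.

Let nbrs_VB_lt y : y \in VB -> nbrs VB y < #|B|.
Proof.
move=> yB; have [yU _ _] := VBP yB.
have := deg_lt yU; rewrite nbrs_VA_VB card_K.
have : #|A| <= nbrs VA y by apply: card_leq_nbrs => i; apply: VB_not_free.
by lia.
Qed.

(** A vertex of [VB] has a neighbour in each class of [A], hence fewer than [#|B|] neighbours in
    [VB]. Removing [y] makes the size right for the induction on colours. *)
Let colour_VB y : y \in VB ->
  exists d, equitable (VB :\ y) B s d.
Proof.
move=> yB; apply: IH => //.
  move=> x /setD1P[_ xB]; apply: leq_ltn_trans (nbrs_VB_lt xB).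
  by apply: leq_nbrs; apply: subsetDl.
by have := card_VB; rewrite (cardsD1 y) yB addnC => /addIn.
Qed.

(** A solo edge: [z] is the only neighbour of [y] in the class of [z], so [y] can take the place of
    [z]. *)
Definition solo y z : bool := h y z && (nbrs (cls (c z)) y == 1).

Lemma solo_uniq y z x : z \in U -> solo y z -> x \in cls (c z) -> x != z -> ~~ h y x.
Proof.
move=> zU /andP[hyz /eqP]; have zz : z \in cls (c z) by rewrite inE zU eqxx.
rewrite /nbrs (bigD1 z zz) /= hyz.
move=> [/eqP]; rewrite sum_nat_eq0 => /forall_inP/(_ x) /= + xz xnz.
by rewrite eqb0; apply; apply/andP.
Qed.

(** * Swapping along a solo edge *)

Section Swap.

Variables (w : C) (z y : T).
Hypothesis wA : w \in A.
Hypothesis wa : w != a.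
Hypothesis zw : z \in cls w.
Hypothesis yB : y \in VB.
Hypothesis yz : solo y z.
Hypothesis w_terminal : {in A :\ w, forall i, reaches mov (K :\ w) a i}.

(** The accessible part once [y] has replaced [z] in class [w]; [z] is left uncoloured for the
    moment. *)
Let US := y |: (VA :\ z).
Let cS := [eta c with y |-> w].

Let zU : z \in U. Proof. by move: zw; rewrite inE => /andP[]. Qed.
Let cz : c z = w. Proof. by move: zw; rewrite inE => /andP[_ /eqP]. Qed.
Let zA : z \in VA. Proof. by rewrite inE zU cz. Qed.
Let yNA : y \notin VA. Proof. by rewrite (disjointFl VA_VB_disjoint). Qed.
Let neq_yz : z != y. Proof. by apply: contraTneq zA => ->. Qed.

Let zNS : z \notin US.
Proof. by rewrite !in_setU1 in_setD1 eqxx (negPf neq_yz). Qed.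

Let cls_VAz i : i \in A -> i != w -> colour_class (VA :\ z) c i = cls i.
Proof.
move=> iA iw; apply/setP=> x; rewrite inE in_setD1 ![x \in colour_preim _ _ _]inE [RHS]inE.
have [cx|_] := eqVneq (c x) i; last by rewrite !andbF.
by rewrite cx iA !andbT andb_idl // => _; apply: contraNneq iw => xz; rewrite -cx xz cz.
Qed.

Let cS_proper : proper_on US cS.
Proof.
apply: proper_on_recolour.
  by move=> x x' /setD1P[_ /setIdP[xU _]] /setD1P[_ /setIdP[xU' _]]; apply: cU.
apply/forall_inP=> x /setIdP[/setD1P[_ /setD1P[xz /setIdP[xU _]]] cx].
by apply: solo_uniq yz _ xz; rewrite // inE xU cz.
Qed.

Let cS_in : {in US, forall x, cS x \in A}.
Proof.
move=> x; rewrite in_setU1 /=; case: eqP => //= _ /setD1P[_].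
by rewrite inE => /andP[].
Qed.

Let cS_class i : i \in A :\ w -> colour_class US cS i = cls i.
Proof.
case/setD1P=> iw iA; rewrite colour_class_recolour ?(negPf iw) ?cls_VAz //.
by rewrite in_setD1 (negPf yNA) andbF.
Qed.

Let cS_class_w : colour_class US cS w = y |: (cls w :\ z).
Proof.
rewrite colour_class_recolour; last by rewrite in_setD1 (negPf yNA) andbF.
rewrite eqxx; congr (_ |: _); apply/setP=> x.
rewrite inE !in_setD1 ![x \in colour_preim _ _ _]inE [x \in cls _]inE.
have [->|_] := eqVneq (c x) w; last by rewrite !andbF.
by rewrite wA !andbT.
Qed.

Let cS_card i : i \in A -> #|colour_class US cS i| + (i == a) = s.
Proof.
move=> iA; rewrite -(card_cls_A iA); congr (_ + _).
have [->|iw] := eqVneq i w; last by rewrite cS_class // in_setD1 iw.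
rewrite cS_class_w cardsU1 (cardsD1 z (cls w)) zw; congr (nat_of_bool _ + _).
rewrite in_setD1 negb_and inE; apply/orP; right.
by have [-> _ yA] := VBP yB; apply: contraNneq yA => ->.
Qed.

Let USE : z |: US = y |: VA.
Proof. by rewrite setUCA (setD1K zA). Qed.

Let US_cover : U = US :|: (z |: (VB :\ y)).
Proof.
by rewrite setUCA setUA USE -setUA setUCA setD1K // -VA_VB.
Qed.

(** Vertices on a path to [a] are accessible, so a path off [w] uses only classes of [A :\ w], which
    the swap does not touch. *)
Let reaches_ADw i : i \in A :\ w -> reaches mov (A :\ w) a i.
Proof.
move/w_terminal; apply: reaches_sub => // j /setD1P[jw jK] Rj.
rewrite in_setD1 jw inE jK; apply: reaches_mono Rj; exact: subsetDl.
Qed.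

(** Inserting [z] at [i] and shifting fills class [a]; [VB] without [y] is coloured separately with
    the colours of [B]. *)
Lemma equitable_of_free_solo i : i \in A :\ w -> free U c z i ->
  exists d, equitable U K s d.
Proof.
move=> iA fz; have [d2 d2E] := colour_VB yB.
have [|||d1 d1E] := @insert_vertex_equitable US A s cS (A :\ w) a i z _ zNS
  cS_proper cS_in cS_card iA.
- exact: subsetDl.
- by rewrite (eq_free _ (cS_class iA)).
- by apply: eq_reaches (reaches_ADw iA) => l lA; rewrite cS_class.
exists (glue (z |: US) d1 d2).
have eU : (z |: US) :|: (VB :\ y) = U.
  by rewrite USE setUAC (setD1K yB) setUC -VA_VB.
have eK : A :|: B = K by rewrite -[RHS](setID K A) (setIidPr AK).
have dU : [disjoint z |: US & VB :\ y].
  rewrite USE disjoints_subset subUset sub1set !inE eqxx /=.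
  by rewrite -disjoints_subset (disjointWr (subsetDl _ _)).
have [_ d1K _] := d1E; have [_ d2K _] := d2E.
by have := glue_equitable A_B_disjoint dU d1K d2K d1E d2E; rewrite eU eK.
Qed.

(** Here [z] goes to a class [v] of a new colouring of [VB :\ y], and [v] becomes the oversized
    class. Since [z] has left [w] and [y] is not adjacent to [y'], the vertex [y'] can now move to
    [w], so its class becomes accessible. *)
Lemma more_accessible_of_solo_pair y' :
    {in A :\ w, forall i, ~~ free U c z i} ->
    y' \in VB -> y' != y -> ~~ h y' y -> solo y' z ->
  exists d b', nearly_equitable U K s d a b' /\
    A \proper accessible (movable U d) K a.
Proof.
move=> nfz y'B y'y hy'y y'z; have [g [gP gB gs]] := colour_VB yB.
have hzy : h z y by rewrite h_sym; case/andP: yz.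
have zNB : z \notin VB :\ y.
  by rewrite in_setD1 (disjointFr VA_VB_disjoint zA) andbF.
(* If no class of [B] were free for [z], its neighbours there, at least [#|A| - 1] more in [VA], and
   [y] would make at least [#|K|]. *)
have [v vB fv] : exists2 v, v \in B & free (VB :\ y) g z v.
  apply/exists_inP; apply: contraTT (deg_lt zU) => /exists_inPn nfB.
  rewrite -leqNgt nbrs_VA_VB card_K.
  have le1 : #|A :\ w| <= nbrs VA z.
    apply: leq_trans (card_leq_nbrs nfz) _; apply: leq_nbrs.
    exact/colour_preimS/subsetDl.
  have le2 : #|B| < nbrs VB z.
    rewrite /nbrs (bigD1 y yB) /= hzy add1n ltnS.
    apply: leq_trans (card_leq_nbrs nfB) _.
    rewrite (eq_bigl (fun x => x \in VB :\ y)); last by move=> x; rewrite in_setD1 andbC.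
    by apply: leq_nbrs; apply/subsetP=> x; rewrite inE => /andP[].
  by rewrite (cardsD1 w A) wA add1n addSnnS leq_add.
pose g' := [eta g with z |-> v].
have g'P : proper_on (z |: VB :\ y) g'.
  apply: proper_on_recolour => //.
  suff -> : (VB :\ y) :\ z = VB :\ y by [].
  by apply/setDidPl; rewrite disjoint_sym disjoints1.
have g'B : {in z |: VB :\ y, forall x, g' x \in B}.
  by move=> x; rewrite in_setU1 /=; case: eqP => //= _; apply: gB.
have dU : [disjoint US & z |: VB :\ y].
  rewrite disjoint_sym disjoints_subset subUset sub1set in_setC zNS /=.
  apply/subsetP=> x /setD1P[xy xB]; rewrite in_setC in_setU1 (negPf xy) /= in_setD1.
  by rewrite (disjointFl VA_VB_disjoint xB) andbF.
pose d := glue US cS g'.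
have eK : A :|: B = K by rewrite -[RHS](setID K A) (setIidPr AK).
have dK := glue_in dU cS_in g'B; rewrite -US_cover eK -/d in dK.
have dP := glue_proper A_B_disjoint dU cS_in g'B cS_proper g'P.
rewrite -US_cover -/d in dP.
have dclA i : i \in A -> colour_class U d i = colour_class US cS i.
  move=> iA; rewrite -(glue_class_l cS A_B_disjoint dU g'B iA) -/d.
  by rewrite -US_cover.
have dclB i : i \in B -> colour_class U d i = colour_class (z |: VB :\ y) g' i.
  move=> iB; rewrite -(glue_class_r g' A_B_disjoint dU cS_in iB) -/d.
  by rewrite -US_cover.
have dcl i : i \in A :\ w -> colour_class U d i = cls i.
  by move=> iA; rewrite dclA ?cS_class //; case/setD1P: iA.
have [vK vA] := setDP vB.
have y'd : d y' \in B.
  have y'S : y' \in z |: VB :\ y by rewrite in_setU1 in_setD1 y'y y'B orbT.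
  by rewrite /d (glue_r _ _ dU) ?g'B.
have accADw i : i \in A :\ w -> reaches (movable U d) K a i.
  move=> iA; apply: (@reaches_mono _ _ (A :\ w)).
    exact: subset_trans (subsetDl _ _) AK.
  by apply: eq_reaches (reaches_ADw iA) => l /dcl.
(* The vertex that moves out of [w] is not [z], which is stuck, so it is still in [w] after the
   swap. *)
have accw : reaches (movable U d) K a w.
  have Rw : reaches mov K a w by move: wA; rewrite inE => /andP[].
  have [wK [j [jKw /= /exists_inP[x xw fx] Rj]]] := reaches_inv Rw wa.
  have jA : j \in A :\ w.
    have [jw jK] := setD1P jKw; rewrite in_setD1 jw inE jK.
    by apply: reaches_mono Rj; apply: subsetDl.
  have jK : j \in K by case/setD1P: jKw.
  apply: reaches_step wK jK _ (accADw _ jA).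
  apply/exists_inP; exists x; last by rewrite (eq_free _ (dcl _ jA)).
  rewrite dclA // cS_class_w in_setU1 in_setD1 xw andbT; apply/orP; right.
  by apply: contraTneq fx => ->; apply: nfz.
have y'K : d y' \in K by case/setDP: y'd.
have [y'U _ _] := VBP y'B.
have accy' : reaches (movable U d) K a (d y').
  apply: reaches_step y'K (subsetP AK _ wA) _ accw.
  apply/exists_inP; exists y'; first by rewrite inE y'U eqxx.
  apply/forall_inP=> x; rewrite dclA // cS_class_w => /setU1P[->//|/setD1P[xz xw]].
  by apply: solo_uniq y'z _ xz; rewrite // cz.
exists d, v; split; last first.
  apply/properP; split; last first.
    by exists (d y'); [rewrite inE y'K|case/setDP: y'd].
  apply/subsetP=> i iA; rewrite inE (subsetP AK) //=.
  have [->//|iw] := eqVneq i w; apply: accADw.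
  by rewrite in_setD1 iw.
split=> //.
  by split=> //; apply: contraNneq vA => <-.
move=> i; rewrite -eK => /setUP[] iK.
  rewrite dclA // cS_card // (_ : i == v = false) ?addn0 //.
  by apply: contraNF vA => /eqP <-.
rewrite dclB // (_ : i == a = false); last first.
  by case/setDP: iK => _; apply: contraNF => /eqP ->.
rewrite addn0 colour_class_recolour //; case: eqP => _; rewrite ?cardsU1 gs ?addn0 //.
by rewrite inE (negPf zNB) addnC.
Qed.

End Swap.

(** * Counting solo edges *)

Let card_cls_J w : w \in A -> w != a -> #|cls w| = s.
Proof. by move=> wA wa; rewrite -(card_cls_A wA) (negPf wa) addn0. Qed.

(** Otherwise each of the [#|B| * s + 1] vertices of [VB] has a neighbour in class [a], which has
    [s - 1] vertices with at most [#|B|] neighbours each. *)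
Let accessible_neq1 : A != [set a].
Proof.
apply/eqP=> A1; have : \sum_(y in VB) 1 <= \sum_(y in VB) nbrs (cls a) y.
  by apply: leq_sum => y yB; apply/nbrs_gt0/VB_not_free.
rewrite sum1_card card_VB sum_nbrsC.
have : \sum_(x in cls a) nbrs VB x <= \sum_(x in cls a) #|B|.
  apply: leq_sum => x; rewrite inE => /andP[xU _].
  have := deg_lt xU; rewrite nbrs_VA_VB card_K A1 cards1 add1n ltnS.
  by apply: leq_trans; apply: leq_addl.
rewrite sum_nat_const -(card_cls_A aA) eqxx.
move: #|B| #|cls a| (\sum_(x in cls a) _) => q t N; clear; nia.
Qed.

(** No vertex of [w] can move to a class of [A] outside [u |: J], so [x] has a neighbour in each of
    these [#|A| - #|J| - 1] classes. *)
Let nbrs_VB_J u J w x : u \in A -> J \subset A :\ u ->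
    {in J & A :\: (u |: J), forall w i, ~~ mov w i} ->
  w \in J -> x \in cls w -> nbrs VB x <= #|B| + #|J|.
Proof.
move=> uA JA nmv wJ xw; have xU : x \in U by move: xw; rewrite inE => /andP[].
have := deg_lt xU; rewrite nbrs_VA_VB card_K.
have : #|A :\: (u |: J)| <= nbrs VA x.
  apply: leq_trans (card_leq_nbrs _) (leq_nbrs _ (colour_preimS _ _ (subsetDl _ _))).
  move=> i iJ; apply: contra (nmv w i wJ iJ) => fx.
  by apply/exists_inP; exists x.
have uJ : u \notin J by apply/negP=> /(subsetP JA); rewrite in_setD1 eqxx.
have uJA : u |: J \subset A.
  by rewrite subUset sub1set uA (subset_trans JA (subsetDl _ _)).
rewrite -[#|A|](cardsID (u |: J)) (setIidPr uJA) cardsU1 uJ.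
move: #|J| #|B| #|_ :\: _| (nbrs VA x) (nbrs VB x) => j q m n n'.
by clear; lia.
Qed.

Let nbrs_VB_stuck w x : w \in A -> x \in cls w ->
  {in A :\ w, forall i, ~~ free U c x i} -> nbrs VB x <= #|B|.
Proof.
move=> wA xw nfx; have xU : x \in U by move: xw; rewrite inE => /andP[].
have := deg_lt xU; rewrite nbrs_VA_VB card_K (cardsD1 w A) wA.
have := leq_trans (card_leq_nbrs nfx) (leq_nbrs x (colour_preimS U c (subsetDl _ _))).
move: #|B| #|_ :\ _| (nbrs VA x) (nbrs VB x) => q m n n'.
by clear; lia.
Qed.

(** Count edges between [VB] and class [w], with weight 2 at the ends [S] of solo edges and weight 1
    elsewhere. Each vertex of [VB] receives at least 2. If [#|J| <= #|B|], each of the [s] vertices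
    of [w] gives at most [2 * #|B|], too little for [#|B| * s + 1] vertices. *)
Let lt_B_J u J w : u \in A -> J \subset A :\ u :\ a -> w \in J ->
    {in J & A :\: (u |: J), forall w i, ~~ mov w i} ->
    {in VB & cls w, forall y z, solo y z -> {in A :\ w, forall i, ~~ free U c z i}} ->
  #|B| < #|J|.
Proof.
move=> uA JA wJ nmv nf.
have /setD1P[wa /setD1P[_ wA]] := subsetP JA w wJ.
pose S := [set z in cls w | [exists y in VB, solo y z]].
have SW : S \subset cls w by apply/subsetP=> z /setIdP[].
have ineq : \sum_(y in VB) 2 <=
    \sum_(y in VB) (nbrs S y * 2 + nbrs (cls w :\: S) y).
  apply: leq_sum => y yB; have ny := nbrs_gt0 (VB_not_free yB wA).
  have eny : nbrs (cls w) y = nbrs S y + nbrs (cls w :\: S) y.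
    by rewrite /nbrs (big_setID S) (setIidPr SW).
  case nS : (nbrs S y) eny => [|m] eny; last by rewrite mulSn -addnA leq_addr.
  rewrite add0n in eny; rewrite mul0n add0n -eny ltn_neqAle ny andbT eq_sym.
  apply/eqP=> n1; have /nbrs_gt0P[z zw hyz] := ny.
  suff /nbrs_gt0P : exists2 x, x \in S & h y x by rewrite nS.
  exists z => //; rewrite inE zw; apply/exists_inP; exists y => //.
  by move: zw; rewrite inE /solo => /andP[_ /eqP->]; rewrite hyz n1 eqxx.
have le1 : \sum_(z in S) nbrs VB z <= #|S| * #|B|.
  rewrite -sum_nat_const; apply: leq_sum => z /setIdP[zw /exists_inP[y yB yz]].
  exact: nbrs_VB_stuck wA zw (nf y z yB zw yz).
have le2 : \sum_(z in cls w :\: S) nbrs VB z <= #|cls w :\: S| * (#|B| + #|J|).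
  rewrite -sum_nat_const; apply: leq_sum => z /setDP[zw _].
  by apply: nbrs_VB_J uA _ nmv wJ zw; apply: subset_trans JA (subsetDl _ _).
have cS : #|S| + #|cls w :\: S| = s.
  by rewrite -(card_cls_J wA wa) -(cardsID S (cls w)) (setIidPr SW).
move: ineq; rewrite sum_nat_const card_VB big_split /= -big_distrl /=.
rewrite (sum_nbrsC VB S) (sum_nbrsC VB (cls w :\: S)) -cS; move: le1 le2.
move: (\sum_(z in S) _) (\sum_(z in _ :\: _) _) #|S| #|_ :\: S| #|B| #|J|.
by clear; nia.
Qed.

(** A class of [J] holds at least two neighbours of [y] unless it gives a solo edge, and any other
    class of [A] holds at least one. The degree bound turns this into many solo edges. *)
Let solo_count J y : J \subset A -> y \in VB ->
  #|J| + (nbrs VB y).+1 <= \sum_(z in colour_preim U c J) solo y z + #|B|.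
Proof.
move=> JA yB; have [yU _ _] := VBP yB.
have := deg_lt yU; rewrite nbrs_VA_VB card_K.
rewrite sum_colour_preim /nbrs sum_colour_preim (big_setID J) /= (setIidPr JA).
have le1 : \sum_(i in J) 2 <=
    \sum_(i in J) (nbrs (cls i) y + \sum_(z in cls i) solo y z).
  apply: leq_sum => i iJ.
  have ny := nbrs_gt0 (VB_not_free yB (subsetP JA _ iJ)).
  have [n1|n1] := eqVneq (nbrs (cls i) y) 1; last first.
    by apply: leq_trans (leq_addr _ _); rewrite ltn_neqAle eq_sym n1.
  rewrite n1 ltnS; have /nbrs_gt0P[z zi hyz] := ny; rewrite (bigD1 z zi) /=.
  have -> : solo y z; last by [].
  by move: zi; rewrite inE /solo => /andP[_ /eqP->]; rewrite hyz n1.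
have le2 : \sum_(i in A :\: J) 1 <= \sum_(i in A :\: J) nbrs (cls i) y.
  apply: leq_sum => i /setDP[iA _]; exact/nbrs_gt0/VB_not_free.
have eA : #|A| = #|J| + #|A :\: J| by rewrite -(cardsID J A) (setIidPr JA).
move: le1 le2; rewrite sum1_card sum_nat_const big_split /= eA.
move: (\sum_(i in J) nbrs _ _) (\sum_(i in J) \sum_(_ in _) (solo _ _ : nat)).
move: (\sum_(i in _ :\: _) _) (\sum_(_ in VB) _) #|J| #|B| #|_ :\: J|.
by clear; lia.
Qed.

Lemma nearly_equitable_improve :
  (exists d, equitable U K s d) \/
  (exists d b', nearly_equitable U K s d a b' /\
     A \proper accessible (movable U d) K a).
Proof.
have [u [J [uA J0 JA nmv term]]] := exists_terminal_set aK accessible_neq1.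
have JA' : J \subset A.
  exact: subset_trans JA (subset_trans (subsetDl _ _) (subsetDl _ _)).
pose bad := [exists w in J, exists z in cls w, exists y in VB,
  solo y z && [exists i in A :\ w, free U c z i]].
have [|/exists_inPn good] := boolP bad.
  case/exists_inP=> w wJ /exists_inP[z zw /exists_inP[y yB /andP[yz]]].
  case/exists_inP=> i iA fz; left.
  exact: (equitable_of_free_solo (subsetP JA' _ wJ) zw yB yz (term w wJ) iA fz).
have {}good w y z : w \in J -> y \in VB -> z \in cls w -> solo y z ->
    {in A :\ w, forall i, ~~ free U c z i}.
  move=> wJ yB zw yz i iA; have /exists_inPn/(_ z zw)/exists_inPn/(_ y yB) := good w wJ.
  by rewrite yz => /exists_inPn; apply.
have qt : #|B| < #|J|.
  have /set0Pn[w wJ] := J0; apply: (lt_B_J uA JA wJ nmv).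
  by move=> y z yB zw; apply: (good w y).
have [I IB [Iindep leI]] := maximal_independent VB.
have {}IB := subsetP IB.
have leI' : \sum_(y in I) (nbrs VB y).+1 <= #|I| * #|B|.
  by rewrite -sum_nat_const; apply: leq_sum => y /IB; apply: nbrs_VB_lt.
have leN : \sum_(y in I) (#|J| + (nbrs VB y).+1) <=
    \sum_(y in I) (\sum_(z in colour_preim U c J) solo y z + #|B|).
  by apply: leq_sum => y /IB; apply: solo_count.
have cJ : #|colour_preim U c J| = #|J| * s.
  rewrite card_colour_preim -sum_nat_const; apply: eq_bigr => w wJ.
  have /setD1P[wa _] := subsetP JA w wJ.
  by rewrite card_cls_J // (subsetP JA').
(* Pigeonhole. From [leI] and [leI'], [#|I| > s]; so [leN] and [leI] give at least
   [s * (#|J| - #|B|) + #|B| * s + 1] solo edges from [I], more than the [#|J| * s] vertices in the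
   classes of [J]. *)
have /exists_inP[z zJ /card_gt1P[y [y' [yI y'I y'y]]]] :
    [exists z in colour_preim U c J, 1 < #|[set y in I | solo y z]|].
  apply: contraT => /exists_inPn le1.
  have : \sum_(z in colour_preim U c J) #|[set y in I | solo y z]| <= #|J| * s.
    rewrite -cJ -sum1_card; apply: leq_sum => z /le1; by rewrite -leqNgt.
  have -> : \sum_(z in colour_preim U c J) #|[set y in I | solo y z]| =
      \sum_(y in I) \sum_(z in colour_preim U c J) solo y z.
    rewrite exchange_big; apply: eq_bigr => z _ /=.
    rewrite -sum1_card big_mkcond [RHS]big_mkcond; apply: eq_bigr => y _ /=.
    by rewrite inE; case: (y \in I); case: (solo y z).
  move: leN leI leI'; rewrite !big_split /= !sum_nat_const card_VB; move: qt.
  move: (\sum_(y in I) (nbrs VB y).+1) (\sum_(y in I) _) #|J| #|B| #|I|.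
  by clear; nia.
move: yI y'I; rewrite !inE => /andP[yI yz] /andP[y'I y'z]; right.
have [zU czJ] := setIdP zJ.
have /setD1P[wa _] := subsetP JA _ czJ.
have zw : z \in cls (c z) by rewrite inE zU eqxx.
apply: (more_accessible_of_solo_pair (subsetP JA' _ czJ) wa zw (IB _ yI) yz
  (term _ czJ) (y' := y')) => //.
- exact: good czJ (IB _ yI) zw yz.
- exact: IB.
- by rewrite eq_sym.
- exact: Iindep.
Qed.

End NearlyEquitable.

(** Induction on the number of inaccessible classes, which each improvement lowers; [a] stays fixed
    while [b] may change. *)
Lemma equitable_of_nearly U K s c a b :
    {in U, forall x, nbrs U x < #|K|} ->
    (forall U' K', K' \proper K -> {in U', forall x, nbrs U' x < #|K'|} ->
      #|U'| = #|K'| * s -> exists d, equitable U' K' s d) ->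
    nearly_equitable U K s c a b ->
  exists d, equitable U K s d.
Proof.
move=> deg IH; have [n] := ubnP (#|K| - #|accessible (movable U c) K a|).
elim: n => // n IHn in c b * => len near.
have [bA|bA] := boolP (b \in accessible (movable U c) K a).
  exact: equitable_of_accessible near bA.
have [//|[d [b' [near' ltA]]]] := nearly_equitable_improve near deg IH bA.
apply: (IHn d b' _ near').
have /subset_leq_card : accessible (movable U d) K a \subset K.
  by apply/subsetP=> i /setIdP[].
by move/proper_card: ltA len; lia.
Qed.

Lemma card_colour_class_recolour U c u i l : u \in U ->
  #|colour_class U [eta c with u |-> i] l| + (l == c u) =
  #|colour_class U c l| + (l == i).
Proof.
move=> uU; have uNU : u \notin U :\ u by rewrite !inE eqxx.
rewrite -{1}(setD1K uU) colour_class_recolour //.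
have -> : #|colour_class U c l| = (l == c u) + #|colour_class (U :\ u) c l|.
  rewrite (cardsD1 u) inE uU eq_sym; congr (_ + #|pred_of_set _|).
  by apply/setP=> x; rewrite !inE andbA.
case: (l == i); last by rewrite addn0 addnC.
by rewrite cardsU1 !inE eqxx /= add1n addn1 addSn addnC.
Qed.

End Colouring.

(** * The Hajnal-Szemeredi theorem *)

Lemma exists_balanced_colouring (T C : finType) (i0 : C) (U : {set T})
    (K : {set C}) (s : nat) :
    #|U| = #|K| * s ->
  exists2 c : T -> C, {in U, forall x, c x \in K} &
    {in K, forall i, #|colour_class U c i| = s}.
Proof.
move eqn : #|K| => n; elim: n => [|n IHn] in U K eqn *.
  move=> /cards0_eq ->; exists (fun=> i0) => [x|i]; first by rewrite inE.
  by rewrite (cards0_eq eqn) inE.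
move=> cU; have /card_gt0P[i iK] : 0 < #|K| by rewrite eqn.
have /card_geqP[r [uniq_r size_r rU]] : s <= #|U| by rewrite cU mulSn leq_addr.
pose S := [set:: r].
have SU : S \subset U by apply/subsetP=> x; rewrite inE => /rU.
have cS : #|S| = s by rewrite cardsE (card_uniqP uniq_r).
have [||c cK cs] := IHn (U :\: S) (K :\ i).
- by move: eqn; rewrite (cardsD1 i) iK => -[].
- by rewrite cardsD (setIidPr SU) cU cS mulSn addnC addnK.
exists (fun x => if x \in S then i else c x) => [x xU|j jK].
  case: ifPn => // xS; have : x \in U :\: S by rewrite in_setD xS.
  by move/cK/setD1P=> [].
have [->|ji] := eqVneq j i.
  rewrite -[RHS]cS; congr #|pred_of_set _|; apply/setP=> x.
  rewrite inE; have [xS|xS] := boolP (x \in S); first by rewrite (subsetP SU) ?eqxx.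
  apply/negbTE/negP=> /andP[xU /eqP cx].
  by have := cK x; rewrite in_setD xS xU cx in_setD1 eqxx => /(_ isT).
rewrite -(cs j) ?in_setD1 ?ji //; congr #|pred_of_set _|; apply/setP=> x.
rewrite !inE -[x \in r]/(x \in r); case: (x \in r) => //=.
by rewrite eq_sym (negPf ji) andbF.
Qed.

Theorem hajnal_szemeredi (T C : finType) (i0 : C) (h : rel T) (U : {set T})
    (K : {set C}) (s : nat) :
    symmetric h -> irreflexive h -> #|U| = #|K| * s ->
    {in U, forall x, nbrs h U x < #|K|} ->
  exists c : T -> C, equitable h U K s c.
Proof.
have [n] := ubnP #|K|; elim: n => // n IHn in h U K * => leKn hsym hirr cU deg.
(* Switch on the edges inside [X] only, enlarging [X] one vertex at a time. *)
pose hX (X : {set T}) := [rel x y | [&& x \in X, y \in X & h x y]].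
suff [c [cP cK cs]] : exists c : T -> C, equitable (hX U) U K s c.
  by exists c; split=> // x y xU yU hxy; apply: cP => //=; rewrite xU yU.
suff IHX m (X : {set T}) : #|X| = m -> X \subset U ->
  exists c : T -> C, equitable (hX X) U K s c by exact: (IHX #|U|).
elim: m X => [|m IHm] X cX XU.
  have [c cK cs] := exists_balanced_colouring i0 cU; exists c; split=> // x y _ _.
  by rewrite (cards0_eq cX) /= inE.
have /card_gt0P[u uX] : 0 < #|X| by rewrite cX.
have [||c [cP cK cs]] := IHm (X :\ u).
- by move: cX; rewrite (cardsD1 u) uX => -[].
- exact: subset_trans (subsetDl _ _) XU.
have uU := subsetP XU u uX.
have hXsym : symmetric (hX X) by move=> x y /=; rewrite hsym andbCA.
have hXirr : irreflexive (hX X) by move=> x /=; rewrite hirr !andbF.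
have degX (Y V : {set T}) x : nbrs (hX Y) V x <= nbrs h V x.
  by apply: leq_sum => y _ /=; case: (h x y); rewrite ?andbF ?leq_b1.
have [i iK fi] : exists2 i, i \in K & free (hX X) U c u i.
  apply/exists_inP; apply: contraTT (deg u uU) => /exists_inPn nf.
  rewrite -leqNgt; apply: leq_trans (card_leq_nbrs nf) _.
  apply: leq_trans (degX _ _ _) (leq_nbrs _ _ _).
  by apply/subsetP=> x /setIdP[].
pose d := [eta c with u |-> i].
have dP : proper_on (hX X) U d.
  rewrite -(setD1K uU); apply: proper_on_recolour => //.
    move=> x y /setD1P[xu xU] /setD1P[yu yU] /= /and3P[xX yX hxy].
    by apply: cP => //=; rewrite !in_setD1 xu yu xX yX.
  apply/forall_inP=> x /setIdP[/setD1P[_ /setD1P[_ xU]] cx].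
  by move/forall_inP: fi; apply; rewrite inE xU.
have dK : {in U, forall x, d x \in K} by move=> x xU /=; case: eqP => // _; apply: cK.
(* Recolouring [u] takes a vertex from class [c u] and adds one to class [i]; if these differ, they
   are the small and the large class. *)
have [iu|iu] := eqVneq i (c u).
  exists d; split=> // l lK; apply/eqP; rewrite -(eqn_add2r (l == c u)).
  by rewrite card_colour_class_recolour // iu cs.
apply: (@equitable_of_nearly _ _ _ _ _ _ _ _ d (c u) i) => //.
- by move=> x xU; apply: leq_ltn_trans (degX _ _ _) (deg _ xU).
- move=> U' K' /proper_card ltK degU' cU'.
  by apply: IHn => //; apply: leq_trans ltK _.
- split=> //; first by split; rewrite ?cK // eq_sym.
  by move=> l lK; rewrite card_colour_class_recolour ?cs.
Qed.

(** * Packings *)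

Lemma count_sorted_ltn (s : seq nat) (k D : nat) :
  sorted leq s -> D <= nth 0 s k -> count (fun d => d < D) s <= k.
Proof.
move=> s_sorted leD; rewrite -[s](cat_take_drop k) count_cat.
suff /eqP-> : count (fun d => d < D) (drop k s) == 0.
  by rewrite addn0 (leq_trans (count_size _ _)) // size_take_min geq_minl.
rewrite -leqn0 leqNgt -has_count; apply/hasPn=> d /(nthP 0)[j].
rewrite size_drop nth_drop => ltj <-; rewrite -leqNgt (leq_trans leD) //.
have ltkj : k + j < size s by rewrite -ltn_subRL.
apply: (sorted_leq_nth leq_trans leqnn 0 s_sorted); rewrite ?inE ?leq_addr //.
by apply: leq_ltn_trans ltkj; apply: leq_addr.
Qed.

Section Packing.

Variables (T : finType) (e : rel T) (r : nat).
Hypothesis e_sym : symmetric e.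
Hypothesis e_irr : irreflexive e.
Hypothesis r_ge2 : 2 <= r.
Implicit Types (U Q : {set T}) (P : {set {set T}}) (x y : T) (m i D : nat).

Definition packing_on U P : Prop :=
  [/\ {in P, forall Q, is_Kr_copy e r Q}, trivIset P & cover P = U].

Lemma nbrs_setT x : nbrs e setT x = degree e x.
Proof.
rewrite /nbrs /degree -sum1_card [RHS]big_mkcond /=.
by apply: eq_big => [y|y _]; rewrite !inE //; case: (e x y).
Qed.

(** [deg_at] counts from 1, so index [k.+1] is entry [k] of the sorted list and only the [k] entries
    before it can be below [D]. Past the end, the default [0] forces [D = 0]. *)
Lemma card_degree_lt k D : D <= deg_at e k.+1 ->
  #|[set x in [set: T] | nbrs e setT x < D]| <= k.
Proof.
move=> leD; have /= := count_sorted_ltn (sort_sorted leq_total _) leD.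
rewrite (permP (permEl (perm_sort _ _))) count_map; apply: leq_trans.
rewrite -sum1_count big_enum_cond -sum1_card /=.
by apply: eq_leq; apply: eq_bigl => x; rewrite !inE nbrs_setT.
Qed.

Lemma nbrs_setD U Q x : Q \subset U -> nbrs e U x = nbrs e Q x + nbrs e (U :\: Q) x.
Proof. by move=> QU; rewrite /nbrs (big_setID Q) (setIidPr QU). Qed.

Lemma packing_on_add U Q P :
  Q \subset U -> is_Kr_copy e r Q -> packing_on (U :\: Q) P -> packing_on U (Q |: P).
Proof.
move=> QU KQ [KP tP cP]; split.
- by move=> R /setU1P[->|/KP].
- apply/trivIsetP=> R R' /setU1P[->|RP] /setU1P[->|R'P] //.
  + by rewrite eqxx.
  + move=> _; rewrite disjoint_sym disjoints_subset.
    apply: subset_trans (_ : U :\: Q \subset _); last exact: subsetDr.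
    by rewrite -cP; apply: bigcup_sup.
  + move=> _; rewrite disjoints_subset.
    apply: subset_trans (_ : U :\: Q \subset _); last exact: subsetDr.
    by rewrite -cP; apply: bigcup_sup.
  + by move/trivIsetP: tP; apply.
- by rewrite -(setID U Q) (setIidPr QU) -cP /cover bigcup_setU big_set1.
Qed.

(** In the complement each vertex has at most [m * r - 1 - (r - 1) * m = m - 1] neighbours, so [m]
    colours suffice; classes of size [r] there are cliques of [e]. *)
Lemma packing_of_min_degree m U :
    #|U| = m * r -> {in U, forall x, (r - 1) * m <= nbrs e U x} ->
  exists P, packing_on U P.
Proof.
move=> cU deg; have [m0|m_gt0] := posnP m.
  exists set0; move: cU; rewrite m0 => /cards0_eq ->; split.
  - by move=> Q; rewrite inE.
  - by apply/trivIsetP=> R R'; rewrite inE.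
  - by rewrite /cover big_set0.
pose h := [rel x y | (x != y) && ~~ e x y].
have [|||x xU|c [cP cK cs]] :=
    @hajnal_szemeredi T 'I_m (Ordinal m_gt0) h U [set: 'I_m] r.
- by move=> x y /=; rewrite eq_sym e_sym.
- by move=> x /=; rewrite eqxx.
- by rewrite cardsT card_ord.
- have : nbrs h U x + nbrs e U x = #|U :\ x|.
    rewrite /nbrs -big_split /= -sum1_card (bigD1 x) //= eqxx e_irr add0n.
    apply: eq_big => y; first by rewrite in_setD1 andbC.
    by rewrite eq_sym => /andP[_ ->]; case: (e x y).
  have := deg x xU; move: cU; rewrite (cardsD1 x) xU cardsT card_ord.
  move: #|_ :\ x| (nbrs h U x) (nbrs e U x) r_ge2 m_gt0; clear; nia.
exists [set colour_class U c i | i : 'I_m]; split.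
- move=> Q /imsetP[i _ ->]; split; first by rewrite cs.
  move=> x y /setIdP[xU /eqP cx] /setIdP[yU /eqP cy] xy.
  apply: contraT => nexy.
  by have := cP x y xU yU; rewrite /= xy nexy cx cy eqxx => /(_ isT).
- apply/trivIsetP=> R R' /imsetP[i _ ->] /imsetP[j _ ->] ij.
  rewrite -setI_eq0; apply/eqP/setP=> x; rewrite !inE; apply/negbTE/negP.
  case/andP=> /andP[_ /eqP cx] /andP[_ /eqP cx'].
  by rewrite -cx -cx' eqxx in ij.
- apply/setP=> x; apply/bigcupP/idP => [[R /imsetP[i _ ->] /setIdP[]]//|xU].
  by exists (colour_class U c (c x)); [apply: imset_f|rewrite inE xU eqxx].
Qed.

(** * A clique through a vertex of small degree *)

Section MinimumVertex.

Variables (m : nat) (U : {set T}) (x : T).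
Hypothesis cU : #|U| = m * r.
Hypothesis xU : x \in U.
Let small := [set y in U | nbrs e U y < (r - 1) * m].
Hypothesis card_small : #|small| <= m.
Hypothesis deg_x : (r - 2) * m < nbrs e U x.

Let common Q := [set y in U | e x y && [forall q in Q, e q y]].

(** A vertex outside [small] misses at most [m] vertices of [U], so each choice costs at most [m]
    common neighbours. Before each choice more than [m] remain, so one of them is not in [small]. *)
Let greedy_clique k : k <= r - 2 ->
  exists Q : {set T}, [/\ Q \subset U, #|Q| = k, {in Q, forall y, e x y},
    {in Q &, forall y z, y != z -> e y z} & (r - 2) * m < #|common Q| + k * m].
Proof.
elim: k => [_|k IHk ltk].
  exists set0; split; rewrite ?sub0set ?cards0 //; try by move=> y; rewrite inE.
  rewrite mul0n addn0 (leq_trans deg_x) // /nbrs -sum1_card big_mkcond.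
  rewrite [leqRHS]big_mkcond; apply: leq_sum => y _; rewrite !inE.
  case: (y \in U) => //=; case: (e x y) => //=.
  by case: ifP => // /forall_inPn[z]; rewrite inE.
have [Q [QU cQ xQ KQ leN]] := IHk (ltnW ltk).
have /subsetPn[v vN vS] : ~~ (common Q \subset small).
  apply/negP=> /subset_leq_card; move: card_small leN ltk r_ge2.
  move: #|small| #|common Q|; clear; nia.
have [vU exv /forall_inP vQ] : [/\ v \in U, e x v & [forall q in Q, e q v]].
  by move: vN; rewrite inE => /and3P[].
have vNQ : v \notin Q by apply/negP=> /vQ; rewrite e_irr.
have degv : (r - 1) * m <= nbrs e U v by move: vS; rewrite inE vU /= -leqNgt.
exists (v |: Q); split.
- by rewrite subUset sub1set vU.
- by rewrite cardsU1 vNQ cQ.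
- by move=> y /setU1P[->//|/xQ].
- move=> y z /setU1P[->|yQ] /setU1P[->|zQ] yz; first by rewrite eqxx in yz.
  + by rewrite e_sym vQ.
  + exact: vQ.
  + exact: KQ.
have leC : #|common Q| <= #|common (v |: Q)| + #|[set y in U | ~~ e v y]|.
  rewrite -(cardsID [set y | e v y]); apply: leq_add; apply: subset_leq_card.
    apply/subsetP=> y; rewrite !inE => /andP[/and3P[-> -> /forall_inP yQ] evy] /=.
    by apply/forall_inP=> q /setU1P[->|/yQ].
  by apply/subsetP=> y; rewrite !inE => /andP[-> /andP[->]].
have eqv : nbrs e U v + #|[set y in U | ~~ e v y]| = #|U|.
  rewrite /nbrs -!sum1_card [X in _ + X]big_mkcond [X in X + _]big_mkcond -big_split.
  rewrite [RHS]big_mkcond; apply: eq_bigr => y _; rewrite inE.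
  by case: (y \in U) => //=; case: (e v y).
move: leN leC eqv degv; rewrite cU; move: #|common Q| #|common _| #|[set _ in _ | _]|.
move: (nbrs e U v) r_ge2; clear; nia.
Qed.

Lemma clique_at_minimum : exists2 Q : {set T}, Q \subset U & is_Kr_copy e r Q /\ x \in Q.
Proof.
have [Q [QU cQ xQ KQ]] := greedy_clique (leqnn _).
(* After [r - 2] choices one common neighbour is still left; the last vertex may be in [small]. *)
rewrite -[X in X < _]add0n ltn_add2r => /card_gt0P[v].
rewrite inE => /and3P[vU exv /forall_inP vQ].
have vNQ : v \notin Q by apply/negP=> /vQ; rewrite e_irr.
have xNQ : x \notin v |: Q.
  rewrite in_setU1 negb_or; apply/andP; split.
    by apply: contraTneq exv => <-; rewrite e_irr.
  by apply/negP=> /xQ; rewrite e_irr.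
exists (x |: (v |: Q)); first by rewrite !subUset !sub1set xU vU.
split; last exact: setU11.
split; first by rewrite !cardsU1 xNQ vNQ cQ; move: r_ge2; clear; lia.
have xvQ y : y \in v |: Q -> e x y by case/setU1P=> [->|/xQ].
move=> y z /setU1P[->|yQ] /setU1P[->|zQ] yz; first by rewrite eqxx in yz.
- exact: xvQ.
- by rewrite e_sym xvQ.
case/setU1P: yQ yz => [->|yQ]; case/setU1P: zQ => [->|zQ] yz.
- by rewrite eqxx in yz.
- by rewrite e_sym vQ.
- exact: vQ.
- exact: KQ.
Qed.

End MinimumVertex.

Lemma nbrs_lt_nonadjacent U x y : y \in U -> x \in U -> x != y -> ~~ e y x ->
  (nbrs e U y).+1 < #|U|.
Proof.
move=> yU xU xy nyx; rewrite (cardsD1 y) yU (cardsD1 x) in_setD1 xy xU !add1n !ltnS.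
rewrite /nbrs (bigD1 y) //= e_irr (bigD1 x) ?xU //= (negPf nyx) !add0n.
rewrite -sum1_card big_mkcond [leqRHS]big_mkcond; apply: leq_sum => z _.
rewrite !inE; case: (z \in U); case: (z == y); case: (z == x) => //=.
exact: leq_b1.
Qed.

(** Bounds on the sorted degrees become bounds on the number of vertices of low degree, a form that
    passes easily to [U :\: Q]. *)
Lemma packing_of_degree_counts m U :
    #|U| = m * r ->
    (forall i, 0 < i -> i < m ->
      #|[set x in U | nbrs e U x < (r - 2) * m + i]| < i) ->
    #|[set x in U | nbrs e U x < (r - 1) * m]| <= m ->
    {in U, forall x, nbrs e U x < (r - 1) * m ->
      forall Q, is_Kr_copy e r.+1 Q -> x \notin Q} ->
  exists P, packing_on U P.
Proof.
elim: m U => [|m IHm] U cU cnt cntm noK.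
  by apply: (@packing_of_min_degree 0) => // x _; rewrite muln0.
have [|[x0]] := set_0Vmem [set x in U | nbrs e U x < (r - 1) * m.+1].
  move=> none; apply: (packing_of_min_degree cU) => x xU.
  by have := in_set0 x; rewrite -none inE xU => /negbT; rewrite -leqNgt.
case/setIdP=> x0U ltx0.
case: (@arg_minnP _ x0 (fun y => y \in U) (nbrs e U) x0U) => x xU minx.
have {ltx0} ltx : nbrs e U x < (r - 1) * m.+1 by apply: leq_ltn_trans (minx _ x0U) ltx0.
have deg_x : (r - 2) * m.+1 < nbrs e U x.
  have [m0|m_gt0] := posnP m; last first.
    have := cnt 1 isT; rewrite ltnS m_gt0 ltnS leqn0 cards_eq0 => /(_ isT)/eqP e0.
    by have := in_set0 x; rewrite -e0 inE xU addn1 ltnS => /negbT; rewrite -ltnNge.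
  (* With a single clique to find, [x] is the only vertex of small degree, so all
     the others are adjacent to it. *)
  rewrite m0 !muln1 ?mul1n in cU ltx cntm *.
  suff adj y : y \in U :\ x -> 1 <= e x y.
    have : #|U :\ x| <= nbrs e U x.
      apply: leq_trans (leq_nbrs _ _ (subsetDl U [set x])).
      by rewrite -sum1_card; apply: leq_sum.
    by move: cU; rewrite (cardsD1 x) xU; move: ltx r_ge2; clear; lia.
  move=> /setD1P[yx yU]; rewrite lt0b; apply: contraT => nxy.
  have lty : nbrs e U y < r - 1.
    have := @nbrs_lt_nonadjacent U x y yU xU; rewrite eq_sym e_sym cU => /(_ yx nxy).
    by clear; lia.
  have : [set x; y] \subset [set z in U | nbrs e U z < r - 1].
    by rewrite subUset !sub1set !inE xU yU ltx lty.
  by move/subset_leq_card; rewrite cards2 eq_sym yx => /leq_trans/(_ cntm).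
have [Q QU [KQ xQ]] := clique_at_minimum cU xU cntm deg_x.
have [cQ eQ] := KQ.
(* A vertex adjacent to all of [Q] would give a [K_(r+1)] through [x]. *)
have lose y : y \in U :\: Q -> nbrs e U y < nbrs e (U :\: Q) y + r.
  case/setDP=> yU yQ; rewrite (nbrs_setD _ QU) addnC ltn_add2l.
  suff [z zQ nyz] : exists2 z, z \in Q & ~~ e y z.
    rewrite -cQ -sum1_card (bigD1 z) // /nbrs (bigD1 z zQ) /= (negPf nyz).
    by rewrite add0n add1n ltnS; apply: leq_sum => t _; apply: leq_b1.
  apply/exists_inP; apply: contraLR (xQ) => /exists_inPn yadj.
  have {}yadj z : z \in Q -> e y z by move/yadj/negPn.
  suff : x \notin y |: Q by rewrite in_setU1 negb_or => /andP[].
  apply: (noK x) => //; split; first by rewrite cardsU1 yQ cQ.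
  move=> z t /setU1P[->|zQ] /setU1P[->|tQ] zt; first by rewrite eqxx in zt.
  - exact: yadj.
  - by rewrite e_sym yadj.
  - exact: eQ.
(* The threshold drops by at most [r - 1], the most a degree can lose, so vertices now low were low
   before. If there are any, the minimum vertex [x] was low too, and its deletion lowers the count
   by one. *)
have shrink D D' k : D + r <= D'.+1 ->
    #|[set y in U | nbrs e U y < D']| <= k.+1 ->
    #|[set y in U :\: Q | nbrs e (U :\: Q) y < D]| <= k.
  move=> leD; set S' := [set y in U :\: Q | _]; set S := [set y in U | _] => leS.
  have SS' : S' \subset S :\ x.
    apply/subsetP=> y /setIdP[yUQ lty]; have [yU yQ] := setDP yUQ.
    rewrite in_setD1 inE yU; apply/andP; split; first by apply: contraNneq yQ => ->.
    by have := lose y yUQ; move: lty leD; clear; lia.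
  have [->|[y yS']] := set_0Vmem S'; first by rewrite cards0.
  have xS : x \in S.
    have /setD1P[_ /setIdP[yU lty]] := subsetP SS' y yS'.
    by rewrite inE xU (leq_ltn_trans (minx y yU)).
  by move: leS (subset_leq_card SS'); rewrite (cardsD1 x S) xS; clear; lia.
have [||||P PP] := IHm (U :\: Q).
- by rewrite cardsD (setIidPr QU) cU cQ mulSn addnC addnK.
- case=> // i _ lti; rewrite ltnS; apply: (shrink _ ((r - 2) * m.+1 + i.+2)).
    by move: r_ge2; clear; nia.
  by rewrite -ltnS; apply: cnt.
- by apply: shrink cntm; move: r_ge2; clear; nia.
- move=> y yUQ lty; have [yU _] := setDP yUQ; apply: noK => //.
  by have := lose y yUQ; move: lty r_ge2; clear; nia.
by exists (Q |: P); apply: packing_on_add.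
Qed.

End Packing.

Theorem theorem5p1 (n r : nat) (T : finType) (e : rel T)
  (hr : 2 <= r) (hrn : r %| n)
  (hG : simple_graph e) (hn : #|T| = n)
  (hdeg : forall i : nat, 1 <= i -> i < n %/ r ->
     ((r - 2) * n) %/ r + i <= deg_at e i)
  (hdeg' : ((r - 1) * n) %/ r <= deg_at e (n %/ r + 1))
  (hK : forall x : T, degree e x < ((r - 1) * n) %/ r ->
     ~ exists K : {set T}, is_Kr_copy e r.+1 K /\ x \in K) :
  exists P : {set {set T}}, perfect_Kr_packing e r P.
Proof.
have [e_sym e_irr] := hG; have [m nE] := dvdnP hrn.
have r_gt0 : 0 < r by apply: leq_trans hr.
rewrite nE !mulnA !mulnK // addn1 in hdeg hdeg' hK.
have [|i i_gt0 lti|||P PP] :=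
    @packing_of_degree_counts T e r e_sym e_irr hr m [set: T].
- by rewrite cardsT hn.
- by case: i i_gt0 lti => // i _ lti; apply/card_degree_lt/hdeg.
- exact: card_degree_lt.
- move=> x _; rewrite nbrs_setT => ltx Q KQ; apply/negP=> xQ.
  by apply: (hK x ltx); exists Q.
by exists P.
Qed.
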